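(* Let $0\le p<\frac23$ and let $\mathcal{N}$ be the single-qubit depolarizing channel with Kraus operators $$\{K_i\}_{i=1}^4=\left\{\sqrt{1-\tfrac{3p}{4}}\,\mathbb{1},\ \tfrac{\sqrt p}{2}X,\ \tfrac{\sqrt p}{2}Y,\ \tfrac{\sqrt p}{2}Z\right\}.$$ Then the Kraus decomposition $K^{(U)}_{i'}=\sum_{i=1}^4U_{i'i}K_i$, $i'\in\{1,\dots,4\}$, with $$U=\frac12\begin{pmatrix}1&1&1&1\\1&1&-1&-1\\1&-1&1&-1\\1&-1&-1&1\end{pmatrix}$$ is optimal for the average entanglement of the Choi state of $\mathcal{N}$.
   Context: $X,Y,Z$ are the Pauli matrices; $p=\frac23$ is the threshold at which the Choi state becomes separable. Let $|\omega\rangle=\frac1{\sqrt2}(|00\rangle+|11\rangle)$ and let $\mathrm{C}(\mathcal{N})=(\mathcal{N}\otimes\mathcal{I})[|\omega\rangle\langle\omega|]$ be the Choi state of a single-qubit channel $\mathcal{N}$. A Kraus decomposition $\{K_i\}_i$ of $\mathcal{N}$ induces the ensemble decomposition $\{p_i,|\phi_i\rangle\}_i$ of $\mathrm{C}(\mathcal{N})$ with $p_i=\|(K_i\otimes\mathbb{1})|\omega\rangle\|_2^2$ and $|\phi_i\rangle=p_i^{-1/2}(K_i\otimes\mathbb{1})|\omega\rangle$. It is called optimal for the (average entanglement of the) Choi state if $\sum_ip_iE(|\phi_i\rangle)=E_{\mathrm{oF}}(\mathrm{C}(\mathcal{N}))$, where $E(|\phi\rangle)=-\mathrm{Tr}[\rho_A\log_2\rho_A]$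 ($\rho_A$ the reduced state on the first qubit) and the entanglement of formation $E_{\mathrm{oF}}(\rho)$ is the infimum of $\sum_iq_iE(|\varphi_i\rangle)$ over all pure-state ensemble decompositions $\rho=\sum_iq_i|\varphi_i\rangle\langle\varphi_i|$. *)

(* Defs.v *)
From mathcomp Require Export all_boot all_order all_algebra.
From mathcomp Require Export complex mxtens.
From mathcomp Require Export all_classical all_reals all_analysis.

Set Implicit Arguments.
Unset Strict Implicit.
Unset Printing Implicit Defensive.

Import Order.TTheory GRing.Theory Num.Theory.

Local Open Scope classical_set_scope.
Local Open Scope ring_scope.
Local Open Scope complex_scope.
Local Open Scope sesquilinear_scope.

Definition mx_of_rows (T : nmodType) (m n : nat) (rows : seq (seq T)) :
    'M[T]_(m, n) :=
  \matrix_(i, j) nth 0 (nth [::] rows i) j.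

Definition pauliX (R : realType) : 'M[R[i]]_2 :=
  mx_of_rows 2 2 [:: [:: 0; 1];
                     [:: 1; 0]].

Definition pauliY (R : realType) : 'M[R[i]]_2 :=
  mx_of_rows 2 2 [:: [:: 0; - 'i];
                     [:: 'i; 0]].

Definition pauliZ (R : realType) : 'M[R[i]]_2 :=
  mx_of_rows 2 2 [:: [:: 1; 0];
                     [:: 0; -1]].

Definition ket (R : realType) (n : nat) (k : 'I_n) : 'cV[R[i]]_n :=
  delta_mx k 0.

(** A bipartite vector has the type ['cV_(m * n)], the first tensor factor
    having dimension [m] and the coordinate on [|j>|k>] sitting at
    [mxtens_index (j, k)]. *)
Definition omega (R : realType) : 'cV[R[i]]_(2 * 2) :=
  ((Num.sqrt 2)^-1)%:C *:
    (ket R (0 : 'I_2) *t ket R (0 : 'I_2) + ket R (1 : 'I_2) *t ket R (1 : 'I_2)).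

Definition pure_state (R : realType) (d : nat) (v : 'cV[R[i]]_d) : 'M[R[i]]_d :=
  v *m v ^t*.

Definition l2norm (R : realType) (d : nat) (v : 'cV[R[i]]_d) : R :=
  Num.sqrt (\sum_(j < d) complex.Re `|v j 0| ^+ 2).

Definition partial_trace2 (R : realType) (m n : nat)
    (rho : 'M[R[i]]_(m * n)) : 'M[R[i]]_m :=
  \matrix_(j, k) \sum_(a < n) rho (mxtens_index (j, a)) (mxtens_index (k, a)).

Definition log2 (R : realType) (x : R) : R := ln x / ln 2.

(** Functional calculus for Hermitian matrices, through the diagonalization
    [A = P^-1 *m diag_mx d *m P] with [P] unitary ([orthomx_spectralP]).
    Since [ln 0 = 0], the term [A *m mx_log2 A] follows the convention
    [0 log 0 = 0]. *)
Definition mx_log2 (R : realType) (d : nat) (A : 'M[R[i]]_d) : 'M[R[i]]_d :=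
  invmx (spectralmx A)
    *m diag_mx (map_mx (fun z => (log2 (complex.Re z))%:C) (spectral_diag A))
    *m spectralmx A.

Definition entropy (R : realType) (d : nat) (rho : 'M[R[i]]_d) : R :=
  - complex.Re (\tr (rho *m mx_log2 rho)).

Definition entanglement (R : realType) (phi : 'cV[R[i]]_(2 * 2)) : R :=
  entropy (partial_trace2 (pure_state phi)).

Definition avg_entanglement (R : realType) (n : nat) (q : 'I_n -> R)
    (phi : 'I_n -> 'cV[R[i]]_(2 * 2)) : R :=
  \sum_(i < n) q i * entanglement (phi i).

Definition ensemble_of (R : realType) (rho : 'M[R[i]]_(2 * 2)) (n : nat)
    (q : 'I_n -> R) (phi : 'I_n -> 'cV[R[i]]_(2 * 2)) : Prop :=
  [/\ forall i, 0 <= q i,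
      \sum_(i < n) q i = 1,
      forall i, l2norm (phi i) = 1
    & rho = \sum_(i < n) (q i)%:C *: pure_state (phi i)].

(** The infimum is taken in the extended reals, so that it is the true one
    without side conditions. *)
Definition entanglement_of_formation (R : realType)
    (rho : 'M[R[i]]_(2 * 2)) : \bar R :=
  ereal_inf [set x : \bar R |
    exists (n : nat) (q : 'I_n -> R) (phi : 'I_n -> 'cV[R[i]]_(2 * 2)),
      ensemble_of rho q phi /\ x = (avg_entanglement q phi)%:E].

Definition kraus_map (R : realType) (n : nat) (K : 'I_n -> 'M[R[i]]_2) :
    'M[R[i]]_2 -> 'M[R[i]]_2 :=
  fun A => \sum_(i < n) K i *m A *m (K i) ^t*.

Definition kraus_decomposition (R : realType)
    (N : 'M[R[i]]_2 -> 'M[R[i]]_2) (n : nat) (K : 'I_n -> 'M[R[i]]_2) : Prop :=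
  \sum_(i < n) (K i) ^t* *m K i = 1%:M /\ forall A, N A = kraus_map K A.

(** [N ⊗ id]: writing [M = \sum_(a, b) M_ab ⊗ |a><b|] with [M_ab] acting on the
    first factor, the image of [M] is [\sum_(a, b) N M_ab ⊗ |a><b|]. *)
Definition tensor_id (R : realType) (N : 'M[R[i]]_2 -> 'M[R[i]]_2)
    (M : 'M[R[i]]_(2 * 2)) : 'M[R[i]]_(2 * 2) :=
  \sum_(a < 2) \sum_(b < 2)
    N (\matrix_(j, k) M (mxtens_index (j, a)) (mxtens_index (k, b)))
      *t delta_mx a b.

Definition choi (R : realType) (N : 'M[R[i]]_2 -> 'M[R[i]]_2) :
    'M[R[i]]_(2 * 2) :=
  tensor_id N (pure_state (omega R)).

Definition kraus_vec (R : realType) (K : 'M[R[i]]_2) : 'cV[R[i]]_(2 * 2) :=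
  (K *t 1%:M) *m omega R.

Definition kraus_prob (R : realType) (K : 'M[R[i]]_2) : R :=
  l2norm (kraus_vec K) ^+ 2.

(** If [kraus_prob K = 0] this is the zero vector (as [0^-1 = 0]); such a term
    has weight [0] in the induced ensemble. *)
Definition kraus_state (R : realType) (K : 'M[R[i]]_2) : 'cV[R[i]]_(2 * 2) :=
  ((Num.sqrt (kraus_prob K))^-1)%:C *: kraus_vec K.

Definition optimal_for_choi (R : realType)
    (N : 'M[R[i]]_2 -> 'M[R[i]]_2) (n : nat) (K : 'I_n -> 'M[R[i]]_2) : Prop :=
  kraus_decomposition N K /\
  (avg_entanglement (fun i => kraus_prob (K i)) (fun i => kraus_state (K i)))%:E
    = entanglement_of_formation (choi N).

Definition depolarizing_kraus (R : realType) (p : R) : 'I_4 -> 'M[R[i]]_2 :=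
  fun i => nth 0
    [:: (Num.sqrt (1 - 3 * p / 4))%:C *: 1%:M;
        (Num.sqrt p / 2)%:C *: pauliX R;
        (Num.sqrt p / 2)%:C *: pauliY R;
        (Num.sqrt p / 2)%:C *: pauliZ R] i.

Definition depolarizing (R : realType) (p : R) : 'M[R[i]]_2 -> 'M[R[i]]_2 :=
  kraus_map (depolarizing_kraus p).

Definition kraus_mix (R : realType) (m n : nat) (U : 'M[R[i]]_(m, n))
    (K : 'I_n -> 'M[R[i]]_2) : 'I_m -> 'M[R[i]]_2 :=
  fun i' => \sum_(i < n) U i' i *: K i.

Definition mixU (R : realType) : 'M[R[i]]_4 :=
  2^-1 *: mx_of_rows 4 4 [:: [:: 1;  1;  1;  1];
                             [:: 1;  1; -1; -1];
                             [:: 1; -1;  1; -1];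
                             [:: 1; -1; -1;  1]].

(* Main.v *)
Require Import Defs.
From mathcomp Require Import ring lra.

(** Write a unit vector of [C^2 (x) C^2] as a 2x2 matrix [M] with
    [tr (M M^* ) = 1].  Its entanglement is an increasing convex function [f]
    of its concurrence [2 |det M|], and [|tr M|^2 <= 1 + 2 |det M|], that is,
    the concurrence is at least [2 |<omega|phi>|^2 - 1].  Averaging over any
    ensemble of the Choi state, whose overlap with [omega] is [1 - 3p/4], the
    mean concurrence is at least [c = 1 - 3p/2 > 0], so the mean entanglement
    is at least [f c] by convexity and monotonicity.  The operators [K^(U)] all
    have weight [1/4] and concurrence exactly [c], so they attain the bound.

    Convexity is proved through the parametrization [c = 1 / cosh t], in which
    [f] is [ln (2 cosh t) - t tanh t] up to the factor [ln 2] and has slope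
    [t / sinh t]. *)

Set Implicit Arguments.
Unset Strict Implicit.
Unset Printing Implicit Defensive.

Import Order.TTheory GRing.Theory Num.Theory.

Local Open Scope ring_scope.
Local Open Scope complex_scope.
Local Open Scope sesquilinear_scope.

(** * Binary entropy as a function of the concurrence *)

Section Hyperbolic.
Import numFieldNormedType.Exports.
Variable R : realType.
Implicit Types s t A a b : R.

(** * Hyperbolic sine and cosine *)

Definition cosh t : R := (expR t + expR (- t)) / 2.
Definition sinh t : R := (expR t - expR (- t)) / 2.

Lemma cosh_gt0 t : 0 < cosh t.
Proof. by rewrite /cosh divr_gt0 ?addr_gt0 ?expR_gt0. Qed.

Lemma sinh0 : sinh 0 = 0.
Proof. by rewrite /sinh oppr0 subrr mul0r. Qed.

Lemma sqr_cosh t : cosh t ^+ 2 = 1 + sinh t ^+ 2.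
Proof.
have E : expR t * expR (- t) = 1 by rewrite -expRD subrr expR0.
by rewrite /cosh /sinh; move: E; set a := expR t; set b := expR _ => E; nra.
Qed.

Lemma is_derive_cosh t : is_derive t 1 cosh (sinh t).
Proof.
rewrite /cosh; apply: is_derive_eq.
by rewrite /sinh /GRing.scale /=; ring.
Qed.

Lemma is_derive_sinh t : is_derive t 1 sinh (cosh t).
Proof.
rewrite /sinh; apply: is_derive_eq.
by rewrite /cosh /GRing.scale /=; ring.
Qed.

Lemma ler_cosh s t : 0 <= s -> s <= t -> cosh s <= cosh t.
Proof.
move=> s0 st; rewrite /cosh ler_pM2r ?invr_gt0 //.
have Es : expR s * expR (- s) = 1 by rewrite -expRD subrr expR0.
have Et : expR t * expR (- t) = 1 by rewrite -expRD subrr expR0.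
have : 1 <= expR s by rewrite -[leLHS]expR0 ler_expR.
have : expR s <= expR t by rewrite ler_expR.
have := expR_gt0 (- s); have := expR_gt0 (- t).
move: Es Et; set a := expR s; set b := expR t; set a' := expR _; set b' := expR _.
move=> Es Et b'0 a'0 ab a1.
(* As [a * a' = b * b' = 1], this product expands to [(b + b') - (a + a')]. *)
have : 0 <= (b - a) * (1 - a' * b').
  by apply: mulr_ge0; nra.
by nra.
Qed.

Lemma ger0_is_derive_le (f df : R -> R) (a b : R) : a <= b ->
  (forall x, a <= x <= b -> is_derive x 1 f (df x)) ->
  (forall x, a <= x <= b -> 0 <= df x) -> f a <= f b.
Proof.
move=> ab Df df0.
have sub x : x \in `]a, b[%R -> a <= x <= b.
  by rewrite in_itv /= => /andP[ax xb]; rewrite !ltW.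
apply: (@ger0_derive1_ndecr _ f a b) => // [x /sub /Df []//|x /sub xab|].
  by rewrite derive1E; have [_ ->] := Df _ xab; exact: df0.
apply: derivable_within_continuous => x; rewrite in_itv /= => xab.
by have [] := Df _ xab.
Qed.

Lemma ler0_is_derive_le (f df : R -> R) (a b : R) : a <= b ->
  (forall x, a <= x <= b -> is_derive x 1 f (df x)) ->
  (forall x, a <= x <= b -> df x <= 0) -> f b <= f a.
Proof.
move=> ab Df df0; rewrite -lerN2.
apply: (@ger0_is_derive_le (\- f) (\- df)) => // x xab.
  by have ? := Df _ xab; apply: is_deriveN.
by rewrite oppr_ge0 df0.
Qed.

Lemma sinh_ge t : 0 <= t -> t <= sinh t.
Proof.
move=> t0; pose f x := sinh x - x.
suff : f 0 <= f t by rewrite /f sinh0 subrr subr_ge0.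
apply: (@ger0_is_derive_le f (fun x => cosh x - 1)) => // x.
  by move=> _; have ? := is_derive_sinh x; apply: is_derive_eq.
move=> /andP[x0 _]; rewrite subr_ge0 -[leLHS](_ : cosh 0 = 1).
  exact: ler_cosh.
by rewrite /cosh oppr0 expR0; field.
Qed.

(** Convexity of [sinh] along a segment from the origin. It makes [u / sinh u] nonincreasing, which
    later gives [A * sinh u - u] its sign. *)
Lemma sinh_scale (l s : R) : 0 <= l <= 1 -> 0 <= s -> sinh (l * s) <= l * sinh s.
Proof.
move=> /andP[l0 l1] s0; pose f x := l * sinh x - sinh (l * x).
suff : f 0 <= f s by rewrite /f mulr0 sinh0 mulr0 subrr subr_ge0.
apply: (@ger0_is_derive_le f (fun x => l * (cosh x - cosh (l * x)))) => // x.
  move=> _; have ? := is_derive_sinh x; have D := is_derive_sinh (l * x).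
  have ? : is_derive x 1 (fun y : R => l * y) l.
    by apply: is_derive_eq; rewrite /GRing.scale /=; ring.
  have ? : is_derive x 1 (sinh \o (fun y : R => l * y)) (l * cosh (l * x)).
    by apply: is_derive_eq; rewrite /GRing.scale /=; ring.
  by apply: is_derive_eq; rewrite /GRing.scale /=; ring.
move=> /andP[x0 _]; rewrite mulr_ge0 // subr_ge0.
by apply: ler_cosh; [rewrite mulr_ge0|rewrite ler_piMl].
Qed.

(* [ln (2 cosh t) - t tanh t] is the entropy of the distribution
   [(e^t, e^-t) / (e^t + e^-t)], and [1 / cosh t] its concurrence. *)
Definition tilted_entropy A t : R :=
  ln (2 * cosh t) - t * sinh t / cosh t - A / cosh t.

(** The two [sinh t / cosh t] terms cancel. The sign is that of [A * sinh t - t], so the tilt [A] is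
    tuned to a point [t] by [A = t / sinh t]. *)
Lemma is_derive_tilted_entropy A t :
  is_derive t 1 (tilted_entropy A) ((A * sinh t - t) / cosh t ^+ 2).
Proof.
have c0 := cosh_gt0 t.
have ? := is_derive_cosh t; have ? := is_derive_sinh t.
have ? : is_derive t 1 (fun x => 2 * cosh x) (2 * sinh t).
  by apply: is_derive_eq; rewrite /GRing.scale /=; ring.
have L : is_derive (2 * cosh t) 1 (@ln R) (2 * cosh t)^-1.
  by apply: is_derive1_ln; rewrite mulr_gt0.
have ? : is_derive t 1 (@ln R \o (fun x => 2 * cosh x)) (sinh t / cosh t).
  apply: is_derive_eq; rewrite /GRing.scale /=.
  by field; rewrite gt_eqF.
have V : is_derive t 1 (fun x => (cosh x)^-1) (- sinh t / cosh t ^+ 2).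
  have ? := is_deriveV (lt0r_neq0 c0).
  apply: is_derive_eq; rewrite /GRing.scale /=; field.
  by rewrite gt_eqF.
(* The identity [cosh^2 - sinh^2 = 1] is inserted by hand, so that the rest is an identity of
   rational functions. *)
have E : A * sinh t - t = A * sinh t - t * (cosh t ^+ 2 - sinh t ^+ 2).
  by rewrite sqr_cosh; ring.
rewrite /tilted_entropy; apply: is_derive_eq; rewrite /GRing.scale /=.
rewrite E; field.
by rewrite gt_eqF.
Qed.

(** The two sign conditions make the function decrease up to [s] and increase after it. In terms of
    the concurrence, the line of slope [A] through the point of parameter [s] supports the entropy
    from below. *)
Lemma tilted_entropy_min A s t : 0 <= s -> 0 <= t ->
  (forall u, 0 <= u <= s -> A * sinh u <= u) ->
  (forall u, s <= u -> u <= A * sinh u) ->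
  tilted_entropy A s <= tilted_entropy A t.
Proof.
move=> s0 t0 As sA; have [st|/ltW ts] := leP s t.
  apply: ger0_is_derive_le st _ _ => [x _|x /andP[sx _]].
    exact: is_derive_tilted_entropy.
  by rewrite divr_ge0 ?sqr_ge0 // subr_ge0 sA.
apply: ler0_is_derive_le ts _ _ => [x _|x /andP[tx xs]].
  exact: is_derive_tilted_entropy.
rewrite mulr_le0_ge0 ?invr_ge0 ?sqr_ge0 // subr_le0 As // xs andbT.
exact: le_trans tx.
Qed.

(** An explicit decay rate in place of a limit at infinity. Without the [A] term, [ln (1 + x) <= x]
    and [tanh t = 1 - e^-t / cosh t] give the bound [(1 + 2 t) e^-2t]; then [(1 + 2 t) e^-t <= 2]
    and [e^-t <= 1 / (1 + t)]. *)
Lemma tilted_entropy_le A t : 0 <= A -> 0 <= t -> tilted_entropy A t <= 2 / (1 + t).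
Proof.
move=> A0 t0; have c0 := cosh_gt0 t.
apply: (@le_trans _ _ (ln (2 * cosh t) - t * sinh t / cosh t)).
  by rewrite lerBlDr lerDl divr_ge0 // ltW.
have E : expR t * expR (- t) = 1 by rewrite -expRD subrr expR0.
have e1 : 1 + t <= expR t by apply: expR_ge1Dx.
have C2 : 2 * cosh t = expR t * (1 + expR (- t) ^+ 2).
  have -> : expR t * (1 + expR (- t) ^+ 2) = expR t + expR t * expR (- t) * expR (- t).
    by ring.
  by rewrite E /cosh; field.
have e0 := expR_gt0 (- t).
rewrite C2 lnM ?posrE ?expR_gt0 ?addr_gt0 ?exprn_gt0 // expRK.
have L : ln (1 + expR (- t) ^+ 2) <= expR (- t) ^+ 2.
  by apply: le_ln1Dx; apply: lt_trans (exprn_gt0 _ e0); lra.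
have -> : t * sinh t / cosh t = t - t * expR (- t) / cosh t.
  by rewrite /sinh /cosh; field; rewrite gt_eqF // addr_gt0 ?expR_gt0.
have H : t * expR (- t) / cosh t <= 2 * t * expR (- t) ^+ 2.
  rewrite ler_pdivrMr // -subr_ge0.
  rewrite [leRHS](_ : _ = t * expR (- t) ^+ 3); last first.
    rewrite /cosh; move: E; set a := expR t; set b := expR _ => E.
    have -> : 2 * t * b ^+ 2 * ((a + b) / 2) = t * b * (a * b) + t * b ^+ 3.
      by field.
    by rewrite E; ring.
  by rewrite mulr_ge0 // exprn_ge0 // ltW.
have : expR (- t) <= (1 + t)^-1 by rewrite expRN lef_pV2 ?posrE ?expR_gt0 //; lra.
have : (1 + 2 * t) * expR (- t) <= 2.
  by move: E e1 e0; set a := expR t; set b := expR _ => E e1 e0; nra.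
rewrite ler_pdivlMr; last by lra.
move: E e1 e0 L H; set a := expR t; set b := expR _; set l := ln _; set h := _ / cosh t.
move=> E e1 e0 L H b1.
rewrite -[(1 + t)^-1]div1r ler_pdivlMr; last by lra.
move=> b2; have lh : l + h <= (1 + 2 * t) * b * b by nra.
have : (1 + 2 * t) * b * (b * (1 + t)) <= 2 * 1 by apply: ler_pM => //; nra.
have : (l + h) * (1 + t) <= (1 + 2 * t) * b * b * (1 + t).
  by rewrite ler_wpM2r //; lra.
lra.
Qed.

(** The minimum lies below values that are eventually arbitrarily small. This is the supporting-line
    inequality at concurrence 0, which corresponds to infinite [t]. *)
Lemma tilted_entropy_le0 A s : 0 <= A -> 0 <= s ->
  (forall u, 0 <= u <= s -> A * sinh u <= u) ->
  (forall u, s <= u -> u <= A * sinh u) ->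
  tilted_entropy A s <= 0.
Proof.
move=> A0 s0 As sA; rewrite leNgt; apply/negP => e0.
(* With [e] the supposedly positive minimum and [t = 2 / e], the decay bound [e * (1 + t) <= 2]
   reads [e + 2 <= 2]. *)
pose t := 2 / tilted_entropy A s.
have t0 : 0 <= t by rewrite divr_ge0 // ltW.
have := le_trans (tilted_entropy_min s0 t0 As sA) (tilted_entropy_le A0 t0).
rewrite ler_pdivlMr; last by lra.
by rewrite mulrDr mulr1 /t mulrCA divff ?gt_eqF //; lra.
Qed.

(** * Binary entropy and its supporting lines *)

Definition binary_entropy (a b : R) : R := - (a * ln a + b * ln b).

(** At [t = ln (a / b) / 2] the pair [(e^t, e^-t)] is proportional to [(a, b)], whence
    [cosh t = 1 / (2 sqrt (a b))] and [tanh t = a - b]. *)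
Lemma tilted_entropyE A a b : 0 < a -> 0 < b -> a + b = 1 ->
  tilted_entropy A (ln (a / b) / 2) =
    binary_entropy a b - A * (2 * Num.sqrt (a * b)).
Proof.
move=> a0 b0 ab; set t := ln _ / 2.
have ab0 : 0 < a * b by rewrite mulr_gt0.
have et : expR t = Num.sqrt (a / b).
  apply/eqP; rewrite -(@eqrXn2 _ 2) ?expR_ge0 ?sqrtr_ge0 // sqr_sqrtr; last first.
    by rewrite divr_ge0 // ltW.
  by rewrite -expRM_natl /t mulrC divfK ?lnK ?posrE ?divr_gt0.
have q0 : 0 < Num.sqrt (a * b) by rewrite sqrtr_gt0.
have q2 : Num.sqrt (a * b) ^+ 2 = a * b by rewrite sqr_sqrtr // ltW.
have et' : expR t = Num.sqrt (a * b) / b.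
  rewrite et [a / b](_ : _ = a * b * b ^- 2); last first.
    by field; rewrite gt_eqF.
  by rewrite sqrtrM ?ltW // -exprVn sqrtr_sqr ger0_norm // invr_ge0 ltW.
have emt : expR (- t) = Num.sqrt (a * b) / a.
  rewrite expRN et' invf_div; set q := Num.sqrt _ in q0 q2 *.
  have -> : b / q = b * q / q ^+ 2 by field; rewrite gt_eqF.
  by rewrite q2; field; rewrite !gt_eqF.
have cE : cosh t = (2 * Num.sqrt (a * b))^-1.
  rewrite /cosh et' emt; set q := Num.sqrt _ in q0 q2 *.
  have -> : q / b + q / a = (a + b) / q.
    have -> : (a + b) / q = (a + b) * q / q ^+ 2.
      by field; rewrite gt_eqF.
    by rewrite q2; field; rewrite !gt_eqF.
  by rewrite ab; field; rewrite gt_eqF.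
have sE : sinh t = (a - b) * cosh t.
  rewrite cE /sinh et' emt; set q := Num.sqrt _ in q0 q2 *.
  have -> : q / b - q / a = (a - b) / q.
    have -> : (a - b) / q = (a - b) * q / q ^+ 2.
      by field; rewrite gt_eqF.
    by rewrite q2; field; rewrite !gt_eqF.
  by field; rewrite gt_eqF.
have c0 := cosh_gt0 t.
have -> : tilted_entropy A t = ln (2 * cosh t) - t * (a - b) - A / cosh t.
  by rewrite /tilted_entropy sE; field; rewrite gt_eqF.
have -> : 2 * cosh t = (Num.sqrt (a * b))^-1.
  by rewrite cE; field; rewrite gt_eqF.
rewrite cE invrK lnV ?posrE //.
have -> : ln (Num.sqrt (a * b)) = (ln a + ln b) / 2.
  rewrite -lnM ?posrE // -[in RHS]q2 lnXn // -[_ *+ 2]mulr_natr; by field.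
rewrite /t ln_div ?posrE // /binary_entropy.
have -> : b = 1 - a by rewrite -ab; ring.
by field.
Qed.

Lemma binary_entropyC a b : binary_entropy a b = binary_entropy b a.
Proof. by rewrite /binary_entropy addrC. Qed.

(* [2 sqrt (a b)] is the concurrence, and the entropy is a convex nondecreasing
   function of it; [A] is the slope of a supporting line. *)
Lemma binary_entropy_support (a b : R) : 0 < a -> 0 < b -> a + b = 1 ->
  exists2 A : R, 0 <= A & forall a' b', 0 <= a' -> 0 <= b' -> a' + b' = 1 ->
    binary_entropy a b + A * (2 * Num.sqrt (a' * b') - 2 * Num.sqrt (a * b))
      <= binary_entropy a' b'.
Proof.
move=> ha hb hab.
wlog ba : a b ha hb hab / b <= a.
  move=> W; have [/W|/ltW ab] := leP b a; first exact.
  have [] := W b a hb ha _ ab; first by rewrite addrC.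
  move=> A A0 H; exists A => // a' b' a'0 b'0 e.
  by rewrite binary_entropyC [a * b]mulrC H.
have ln_ge0 (x y : R) : 0 < x -> 0 < y -> y <= x -> 0 <= ln (x / y) / 2.
  by move=> x0 y0 yx; rewrite divr_ge0 // ln_ge0 // ler_pdivlMr // mul1r.
pose s := ln (a / b) / 2; have s0 : 0 <= s by exact: ln_ge0.
have [A [A0 As sA]] : exists A : R, [/\ 0 <= A,
    forall u : R, 0 <= u <= s -> A * sinh u <= u &
    forall u : R, s <= u -> u <= A * sinh u].
  move: s0; rewrite le_eqVlt => /predU1P[<-|s0].
    (* At [s = 0], that is [a = b], the slope [s / sinh s] is replaced by its limit 1. *)
    exists 1; split=> // u; last by rewrite mul1r; exact: sinh_ge.
    by rewrite -eq_le => /eqP <-; rewrite sinh0 mulr0.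
  have sh0 : 0 < sinh s := lt_le_trans s0 (sinh_ge (ltW s0)).
  (* Since [u / sinh u] is nonincreasing, it is at least [s / sinh s] before [s] and at most that
     after [s]. *)
  exists (s / sinh s); split=> [|u|u]; first by rewrite divr_ge0 ?ltW.
    move=> /andP[u0 us]; have us01 : 0 <= u / s <= 1.
      by rewrite divr_ge0 ?(ltW s0) //= ler_pdivrMr // mul1r.
    have := sinh_scale us01 (ltW s0); rewrite divfK ?gt_eqF // => H.
    by rewrite mulrAC ler_pdivrMr // mulrC -ler_pdivlMr // mulrAC.
  move=> su; have u0 : 0 < u := lt_le_trans s0 su.
  have su01 : 0 <= s / u <= 1.
    by rewrite divr_ge0 ?(ltW s0) ?(ltW u0) //= ler_pdivrMr // mul1r.
  have := sinh_scale su01 (ltW u0); rewrite divfK ?gt_eqF // => H.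
  by rewrite mulrAC ler_pdivlMr // mulrC -ler_pdivlMr // mulrAC.
have sE := tilted_entropyE A ha hb hab.
exists A => // a' b'.
wlog ba' : a' b' / b' <= a'.
  move=> W a'0 b'0 e; have [/W|/ltW ab] := leP b' a'; first exact.
  by rewrite [binary_entropy a' _]binary_entropyC [a' * _]mulrC W // addrC.
move=> a'0; rewrite le_eqVlt => /predU1P[<-|b'0] e.
  (* For [b' = 0] no finite [t] represents the pair; the inequality says that the minimum of the
     tilted entropy is nonpositive. *)
  move: e; rewrite addr0 => ->.
  rewrite mulr0 sqrtr0 mulr0 sub0r /binary_entropy ln1 mul0r mulr0 addr0 oppr0.
  by rewrite mulrN -sE; exact: tilted_entropy_le0.
have {}a'0 : 0 < a' := lt_le_trans b'0 ba'.
have := tilted_entropy_min s0 (ln_ge0 _ _ a'0 b'0 ba') As sA.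
by rewrite sE tilted_entropyE // mulrBr; lra.
Qed.

End Hyperbolic.

(** * Entanglement of two-qubit pure states *)

Lemma weighted_mean_const (S : pzRingType) n (q f : 'I_n -> S) (c : S) :
  \sum_i q i = 1 -> (forall i, f i = c) -> \sum_i q i * f i = c.
Proof.
move=> q1 fc; under eq_bigr do rewrite fc.
by rewrite -mulr_suml q1 mul1r.
Qed.

Section Quantum.
Variable R : realType.
Local Notation C := R[i].

Lemma sum_ord2 (V : nmodType) (F : 'I_2 -> V) : \sum_i F i = F 0 + F 1.
Proof.
by rewrite !big_ord_recl big_ord0 addr0; congr (_ + F _); exact: val_inj.
Qed.

Lemma prod_ord2 (S : pzSemiRingType) (F : 'I_2 -> S) : \prod_i F i = F 0 * F 1.
Proof.
by rewrite !big_ord_recl big_ord0 mulr1; congr (_ * F _); exact: val_inj.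
Qed.

Lemma conj_RtoC (x : R) : Num.conj (x%:C : C) = x%:C.
Proof. by apply: conj_Creal; rewrite complex_real. Qed.

Lemma RtoCD (x y : R) : (x + y)%:C = x%:C + y%:C :> C.
Proof. exact: rmorphD. Qed.

Lemma RtoCM (x y : R) : (x * y)%:C = x%:C * y%:C :> C.
Proof. exact: rmorphM. Qed.

Lemma RtoCX (x : R) n : (x ^+ n)%:C = x%:C ^+ n :> C.
Proof. exact: rmorphXn. Qed.

Lemma RtoCV (x : R) : (x^-1)%:C = x%:C^-1 :> C.
Proof. exact: fmorphV. Qed.

Lemma RtoC_nat n : (n%:R)%:C = n%:R :> C.
Proof. exact: rmorph_nat. Qed.

Lemma RtoC_sum (I : finType) (F : I -> R) :
  (\sum_i F i)%:C = \sum_i (F i)%:C :> C.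
Proof. exact: rmorph_sum. Qed.

(** * Trace, determinant and entropy through the spectrum *)

Lemma tr_diag_mx_mul d (A : 'M[C]_d) (f : C -> C) : A \is normalmx ->
  \tr (A *m (invmx (spectralmx A) *m diag_mx (map_mx f (spectral_diag A))
     *m spectralmx A)) = \sum_j spectral_diag A 0 j * f (spectral_diag A 0 j).
Proof.
move=> /orthomx_spectralP; set P := spectralmx A; set D := spectral_diag A => E.
have uP : P \in unitmx by exact: spectral_unit.
rewrite [X in X *m _]E !mulmxA mulmxK // -mulmxA mxtrace_mulC mulmxA.
rewrite mulmxK // mulmx_diag mxtrace_diag.
by apply: eq_bigr => j _; rewrite !mxE mulrC.
Qed.

Lemma spectral_mxtrace d (A : 'M[C]_d) : A \is normalmx ->
  \tr A = \sum_j spectral_diag A 0 j.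
Proof.
move=> /orthomx_spectralP {1}->.
by rewrite mxtrace_mulC mulmxA mulmxV ?spectral_unit // mul1mx mxtrace_diag.
Qed.

Lemma spectral_det d (A : 'M[C]_d) : A \is normalmx ->
  \det A = \prod_j spectral_diag A 0 j.
Proof.
move=> /orthomx_spectralP {1}->.
rewrite !det_mulmx mulrAC -det_mulmx mulVmx ?spectral_unit // det1 mul1r.
exact: det_diag.
Qed.

Lemma entropy_spectral d (A : 'M[C]_d) : A \is hermsymmx ->
  let ev j := complex.Re (spectral_diag A 0 j) in
  entropy A = - \sum_j ev j * log2 (ev j).
Proof.
move=> Ah ev; have Dr := hermitian_spectral_diag_real Ah.
rewrite /entropy /mx_log2 tr_diag_mx_mul ?hermitian_normalmx //.
rewrite (_ : \sum_j _ = (\sum_j ev j * log2 (ev j))%:C) //.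
rewrite RtoC_sum; apply: eq_bigr => j _.
by rewrite [RHS]RtoCM /ev RRe_real // (mxOverP Dr).
Qed.

Lemma mulmx_trmxC_herm m n (M : 'M[C]_(m, n)) : M *m M ^t* \is hermsymmx.
Proof.
by apply/is_hermitianmxP; rewrite expr0 scale1r trmx_mul map_mxM /= trmxCK.
Qed.

(** The reshaping under which the reduced state is [M *m M ^t*], the squared norm its trace, and a
    Kraus vector the Kraus operator up to a scalar. *)
Definition coef_mx m n (phi : 'cV[C]_(m * n)) : 'M[C]_(m, n) :=
  \matrix_(j, a) phi (mxtens_index (j, a)) 0.

Lemma coef_mxZ m n (a : C) (phi : 'cV[C]_(m * n)) :
  coef_mx (a *: phi) = a *: coef_mx phi.
Proof. by apply/matrixP => i j; rewrite !mxE. Qed.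

Lemma pure_stateE d (v : 'cV[C]_d) x y :
  pure_state v x y = v x 0 * Num.conj (v y 0).
Proof. by rewrite mxE big_ord1 !mxE. Qed.

Lemma partial_trace2_pure m n (phi : 'cV[C]_(m * n)) :
  partial_trace2 (pure_state phi) = coef_mx phi *m (coef_mx phi) ^t*.
Proof.
apply/matrixP => i j; rewrite !mxE; apply: eq_bigr => a _.
by rewrite !mxE big_ord1 !mxE.
Qed.

Lemma sum_mxtens m n (F : 'I_(m * n) -> C) :
  \sum_k F k = \sum_i \sum_j F (mxtens_index (i, j)).
Proof.
rewrite pair_big (reindex (@mxtens_index m n)) /=; last first.
  by exists (@mxtens_unindex m n) => i _; rewrite ?mxtens_indexK ?mxtens_unindexK.
by apply: eq_bigr => -[].
Qed.

Lemma sqr_l2norm d (v : 'cV[C]_d) : (l2norm v ^+ 2)%:C = \sum_j `|v j 0| ^+ 2.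
Proof.
rewrite sqr_sqrtr; last by apply: sumr_ge0 => j _; rewrite sqr_ge0.
rewrite RtoC_sum; apply: eq_bigr => j _.
by rewrite RtoCX RRe_real // normr_real.
Qed.

Lemma mxtrace_coef m n (phi : 'cV[C]_(m * n)) :
  \tr (coef_mx phi *m (coef_mx phi) ^t*) = (l2norm phi ^+ 2)%:C.
Proof.
rewrite sqr_l2norm sum_mxtens; apply: eq_bigr => i _; rewrite !mxE.
by apply: eq_bigr => j _; rewrite !mxE -normCK.
Qed.

Definition concurrence (phi : 'cV[C]_(2 * 2)) : R :=
  2 * complex.Re `|\det (coef_mx phi)|.

(** The witnesses are the eigenvalues of the reduced state [M *m M ^t*]: their sum is its trace 1,
    their product its determinant [|det M|^2]. *)
Lemma entanglement_binary (phi : 'cV[C]_(2 * 2)) : l2norm phi = 1 ->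
  exists a b : R, [/\ 0 <= a, 0 <= b, a + b = 1,
    concurrence phi = 2 * Num.sqrt (a * b) &
    entanglement phi = binary_entropy a b / ln 2].
Proof.
move=> phi1; rewrite /entanglement partial_trace2_pure.
have := mxtrace_coef phi; rewrite phi1 expr1n /concurrence.
set M := coef_mx phi => trM.
have hM := mulmx_trmxC_herm M; have nM := hermitian_normalmx hM.
have Dr := mxOverP (hermitian_spectral_diag_real hM) 0.
have tE := spectral_mxtrace nM; have dE := spectral_det nM.
rewrite (entropy_spectral hM).
move: Dr tE dE; rewrite {}trM; set D := spectral_diag _ => Dr tE dE.
pose ev j := complex.Re (D 0 j).
have evE j : D 0 j = (ev j)%:C by rewrite /ev RRe_real.
have t1 : ev 0 + ev 1 = 1.
  by apply: complexI; rewrite RtoCD -!evE tE sum_ord2.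
have d1 : ev 0 * ev 1 = complex.Re `|\det M| ^+ 2.
  apply: complexI; rewrite RtoCM RtoCX RRe_real ?normr_real //.
  rewrite normCK -!evE; move: dE; rewrite prod_ord2.
  by rewrite det_mulmx det_map_mx det_tr => ->.
have d0 : 0 <= ev 0 * ev 1 by rewrite d1 sqr_ge0.
(* Two reals with sum 1 and nonnegative product are both nonnegative. *)
have e0 : 0 <= ev 0 by nra.
have e1 : 0 <= ev 1 by nra.
exists (ev 0), (ev 1); split=> //.
  rewrite d1 sqrtr_sqr [`|complex.Re _|]ger0_norm //.
  by have := normr_ge0 (\det M); rewrite lecE => /andP[].
rewrite sum_ord2 /binary_entropy /log2.
by rewrite mulNr mulrDl !mulrA.
Qed.

(** Positive concurrence makes both eigenvalues positive, so [binary_entropy_support] applies; the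
    factor [ln 2] is absorbed in the slope. *)
Lemma entanglement_support (phi : 'cV[C]_(2 * 2)) :
  l2norm phi = 1 -> 0 < concurrence phi ->
  exists2 A : R, 0 <= A & forall psi, l2norm psi = 1 ->
    entanglement phi + A * (concurrence psi - concurrence phi) <= entanglement psi.
Proof.
move=> /entanglement_binary[a [b [a0 b0 ab -> ->]]] c0.
have ab0 : 0 < a * b by rewrite -sqrtr_gt0 -(pmulr_rgt0 _ (ltr0n _ 2)).
have {}a0 : 0 < a by nra.
have {}b0 : 0 < b by nra.
have [A A0 H] := binary_entropy_support a0 b0 ab.
have l2 : 0 < ln (2 : R) by rewrite ln_gt0 // ltr1n.
exists (A / ln 2); first by rewrite divr_ge0 // ltW.
move=> psi /entanglement_binary[a' [b' [a'0 b'0 ab' -> ->]]].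
by rewrite mulrAC -mulrDl ler_pM2r ?invr_gt0 // H.
Qed.

(** With equal concurrences the linear term vanishes, and the supporting lines at the two states
    give opposite inequalities. *)
Lemma eq_entanglement (phi psi : 'cV[C]_(2 * 2)) :
  l2norm phi = 1 -> l2norm psi = 1 -> 0 < concurrence phi ->
  concurrence phi = concurrence psi -> entanglement phi = entanglement psi.
Proof.
move=> p1 q1 p0 pq; have q0 : 0 < concurrence psi by rewrite -pq.
have [A _ /(_ _ q1)] := entanglement_support p1 p0.
have [B _ /(_ _ p1)] := entanglement_support q1 q0.
rewrite pq; move: (entanglement phi) (entanglement psi) => x y.
by rewrite subrr !mulr0 !addr0 => yx xy; apply/le_anti/andP.
Qed.

(** * Concurrence against overlap with [omega] *)

Lemma det_mx2 (S : comPzRingType) (M : 'M[S]_2) :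
  \det M = M 0 0 * M 1 1 - M 0 1 * M 1 0.
Proof.
rewrite (expand_det_row _ 0) sum_ord2 /cofactor !det_mx11 !mxE /= expr0 expr1.
rewrite mul1r mulN1r mulrN.
by congr (_ * M _ _ - _ * M _ _); exact: val_inj.
Qed.

(** For entries [a, b, c, d], combine [|a + d| <= |a| + |d|], [|a d| <= |a d - b c| + |b c|] and
    [2 |b c| <= |b|^2 + |c|^2]. *)
Lemma sqr_norm_mxtrace2 (M : 'M[C]_2) :
  `|\tr M| ^+ 2 <= \tr (M *m M ^t*) + 2 * `|\det M|.
Proof.
rewrite det_mx2 /mxtrace !sum_ord2 !mxE !sum_ord2 !mxE -!normCK.
set a := M 0 0; set b := M 0 1; set c := M 1 0; set d := M 1 1.
have H1 : `|a + d| ^+ 2 <= (`|a| + `|d|) ^+ 2.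
  by rewrite ler_pXn2r ?nnegrE ?addr_ge0 // ler_normD.
have H2 : `|a| * `|d| <= `|a * d - b * c| + `|b| * `|c|.
  rewrite -!normrM; apply: le_trans (ler_normD _ _).
  by rewrite subrK.
have H3 : 0 <= (`|b| - `|c|) ^+ 2 by rewrite real_exprn_even_ge0 // realB ?normr_real.
apply: (le_trans H1); rewrite -subr_ge0.
have -> : `|a| ^+ 2 + `|b| ^+ 2 + (`|c| ^+ 2 + `|d| ^+ 2) + 2 * `|a * d - b * c|
   - (`|a| + `|d|) ^+ 2 =
   (`|b| - `|c|) ^+ 2 + 2 * (`|a * d - b * c| + `|b| * `|c| - `|a| * `|d|).
  by ring.
by rewrite addr_ge0 // mulr_ge0 // subr_ge0.
Qed.

(* [overlap rho] is [2 <omega|rho|omega>]. *)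
Definition overlap (rho : 'M[C]_(2 * 2)) : C :=
  \sum_(a < 2) \sum_(b < 2) rho (mxtens_index (a, a)) (mxtens_index (b, b)).

Lemma overlap_sum (I : finType) (q : I -> C) (rho : I -> 'M[C]_(2 * 2)) :
  overlap (\sum_i q i *: rho i) = \sum_i q i * overlap (rho i).
Proof.
rewrite /overlap.
under [RHS]eq_bigr do rewrite mulr_sumr.
rewrite [RHS]exchange_big; apply: eq_bigr => a _ /=.
under [RHS]eq_bigr do rewrite mulr_sumr.
rewrite [RHS]exchange_big; apply: eq_bigr => b _ /=.
by rewrite summxE; apply: eq_bigr => i _; rewrite mxE.
Qed.

Lemma overlap_pure (phi : 'cV[C]_(2 * 2)) :
  overlap (pure_state phi) = `|\tr (coef_mx phi)| ^+ 2.
Proof.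
rewrite normCK rmorph_sum mulr_suml; apply: eq_bigr => a _.
rewrite mulr_sumr; apply: eq_bigr => b _.
by rewrite !mxE big_ord1 !mxE.
Qed.

Lemma overlap_concurrence (phi : 'cV[C]_(2 * 2)) : l2norm phi = 1 ->
  overlap (pure_state phi) <= (1 + concurrence phi)%:C.
Proof.
move=> phi1; rewrite overlap_pure; apply: le_trans (sqr_norm_mxtrace2 _) _.
rewrite mxtrace_coef phi1 expr1n RtoCD RtoCM RRe_real ?normr_real //.
by rewrite rmorph_nat.
Qed.

(** A Jensen argument with the supporting line at [phi], a reference state whose concurrence is the
    one forced by the overlap of [rho]. *)
Lemma avg_entanglement_ge (phi : 'cV[C]_(2 * 2)) (rho : 'M[C]_(2 * 2)) n
    (q : 'I_n -> R) (psi : 'I_n -> 'cV[C]_(2 * 2)) :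
  l2norm phi = 1 -> 0 < concurrence phi ->
  overlap rho = (1 + concurrence phi)%:C ->
  ensemble_of rho q psi -> entanglement phi <= avg_entanglement q psi.
Proof.
move=> phi1 c0 ov [q0 q1 psi1 rhoE].
have [A A0 H] := entanglement_support phi1 c0.
(* The overlap is linear in the state, so [overlap_concurrence] can be averaged; the constant 1
   becomes the sum of the weights. *)
have cq : concurrence phi <= \sum_i q i * concurrence (psi i).
  rewrite -(lerD2l 1) -lecR -ov rhoE overlap_sum -{1}q1 -big_split /=.
  rewrite RtoC_sum; apply: ler_sum => i _.
  rewrite -{2}[q i]mulr1 -mulrDr RtoCM ler_wpM2l ?ler0c //.
  exact: overlap_concurrence.
apply: (@le_trans _ _ (\sum_i q i *
    (entanglement phi + A * (concurrence (psi i) - concurrence phi)))).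
  rewrite (_ : \sum_i _ = entanglement phi * (\sum_i q i) +
    A * (\sum_i q i * concurrence (psi i) - concurrence phi * \sum_i q i)).
    by rewrite q1 !mulr1 lerDl mulr_ge0 // subr_ge0.
  rewrite !mulr_sumr -sumrB mulr_sumr -big_split; apply: eq_bigr => i _ /=.
  by ring.
by apply: ler_sum => i _; apply: ler_wpM2l => //; apply: H.
Qed.

End Quantum.

(** * Ensembles induced by Kraus operators *)

Section Kraus.
Variable R : realType.
Local Notation C := R[i].

Lemma omegaE (j a : 'I_2) :
  omega R (mxtens_index (j, a)) 0 = ((Num.sqrt 2)^-1)%:C * (j == a)%:R.
Proof.
rewrite !mxE !mxtens_indexK /= -!natrM !mulnb -natrD; congr (_ * _%:R).
by case: j a => [[|[|//]] ?] [[|[|//]] ?].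
Qed.

Lemma sum_delta n (a : 'I_n) (F : 'I_n -> C) : \sum_i F i * (i == a)%:R = F a.
Proof.
by rewrite (bigD1 a) //= eqxx mulr1 big1 ?addr0 // => i /negbTE ->; rewrite mulr0.
Qed.

Lemma coef_kraus_vec (K : 'M[C]_2) :
  coef_mx (kraus_vec K) = ((Num.sqrt 2)^-1)%:C *: K.
Proof.
set c := (_ ^-1)%:C.
apply/matrixP => j a; rewrite !mxE sum_mxtens.
transitivity (\sum_i (\sum_b c * K j i * (i == b)%:R * (b == a)%:R)).
  apply: eq_bigr => i _; apply: eq_bigr => b _.
  by rewrite omegaE mxE !mxtens_indexK /= mxE [a == b]eq_sym /c; ring.
by under eq_bigr do rewrite sum_delta; rewrite sum_delta.
Qed.

Lemma choi_kraus_map n (K : 'I_n -> 'M[C]_2) :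
  choi (kraus_map K) = \sum_i pure_state (kraus_vec (K i)).
Proof.
set c : C := ((Num.sqrt 2)^-1)%:C.
have cE (L : 'M[C]_2) l d : kraus_vec L (mxtens_index (l, d)) 0 = c * L l d.
  by have /matrixP/(_ l d) := coef_kraus_vec L; rewrite mxE [RHS]mxE.
apply/matrixP => x y; case: (mxtens_indexP x) => j a; case: (mxtens_indexP y) => k b.
rewrite /choi /tensor_id.
pose block a b : 'M[C]_2 := \matrix_(j, k)
  pure_state (omega R) (mxtens_index (j, a)) (mxtens_index (k, b)).
(* The factor [delta_mx a' b'] leaves only the block with [a' = a] and [b' = b] in this entry. *)
transitivity (kraus_map K (block a b) j k).
  rewrite summxE; under eq_bigr do rewrite summxE.
  transitivity (\sum_a' (\sum_b' kraus_map K (block a' b') j k *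
      (a' == a)%:R * (b' == b)%:R)).
    apply: eq_bigr => a' _; apply: eq_bigr => b' _.
    rewrite mxE !mxtens_indexK /= mxE [a == a']eq_sym [b == b']eq_sym.
    by rewrite -mulrA -natrM mulnb.
  by under eq_bigr do rewrite sum_delta; rewrite sum_delta.
rewrite !summxE; apply: eq_bigr => i _.
rewrite pure_stateE !cE.
transitivity (\sum_k' \sum_j' (K i j j' * c * c * Num.conj (K i k k'))
    * (j' == a)%:R * (k' == b)%:R).
  rewrite mxE; apply: eq_bigr => k' _; rewrite mxE mulr_suml.
  apply: eq_bigr => j' _; rewrite mxE pure_stateE !omegaE 2!mxE.
  by rewrite rmorphM /= conj_RtoC conjC_nat -/c; ring.
under eq_bigr do rewrite -mulr_suml sum_delta.
by rewrite sum_delta rmorphM /= conj_RtoC -/c; ring.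
Qed.

Lemma kraus_probE (K : 'M[C]_2) : (kraus_prob K)%:C = 2^-1 * \tr (K *m K ^t*).
Proof.
rewrite -mxtrace_coef coef_kraus_vec linearZ map_mxZ /= conj_RtoC.
rewrite -scalemxAl -scalemxAr scalerA mxtraceZ; congr (_ * _).
rewrite -RtoCM -invfM -expr2 sqr_sqrtr ?ler0n //.
by rewrite RtoCV RtoC_nat.
Qed.

Lemma l2normZ d (r : R) (v : 'cV[C]_d) : l2norm (r%:C *: v) ^+ 2 = r ^+ 2 * l2norm v ^+ 2.
Proof.
apply: complexI; rewrite [RHS]RtoCM !sqr_l2norm mulr_sumr; apply: eq_bigr => j _.
by rewrite mxE normrM exprMn RtoCX; congr (_ * _); rewrite normCK conj_RtoC expr2.
Qed.

Lemma l2norm_kraus_state (K : 'M[C]_2) : 0 < kraus_prob K -> l2norm (kraus_state K) = 1.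
Proof.
move=> K0; apply/eqP; rewrite -(@eqrXn2 _ 2) ?sqrtr_ge0 // l2normZ expr1n.
by rewrite exprVn (sqr_sqrtr (ltW K0)) -/(kraus_prob K) mulVf // lt0r_neq0.
Qed.

Lemma pure_kraus_state (K : 'M[C]_2) : 0 < kraus_prob K ->
  (kraus_prob K)%:C *: pure_state (kraus_state K) = pure_state (kraus_vec K).
Proof.
move=> K0; rewrite /kraus_state /pure_state linearZ map_mxZ /= conj_RtoC.
rewrite -scalemxAl -scalemxAr !scalerA -!RtoCM -mulrA -expr2 exprVn.
by rewrite (sqr_sqrtr (ltW K0)) mulfV ?lt0r_neq0 // scale1r.
Qed.

Lemma sum_kraus_prob n (K : 'I_n -> 'M[C]_2) :
  \sum_i (K i) ^t* *m K i = 1%:M -> \sum_i kraus_prob (K i) = 1.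
Proof.
move=> K1; apply: complexI; rewrite RtoC_sum.
under eq_bigr do rewrite kraus_probE mxtrace_mulC.
by rewrite -mulr_sumr -raddf_sum K1 /= mxtrace1 mulVf ?pnatr_eq0.
Qed.

Lemma kraus_ensemble n (K : 'I_n -> 'M[C]_2) :
  \sum_i (K i) ^t* *m K i = 1%:M -> (forall i, 0 < kraus_prob (K i)) ->
  ensemble_of (choi (kraus_map K)) (fun i => kraus_prob (K i))
    (fun i => kraus_state (K i)).
Proof.
move=> K1 K0; split=> [i|||]; first exact: ltW.
- exact: sum_kraus_prob.
- by move=> i; exact: l2norm_kraus_state.
- by rewrite choi_kraus_map; apply: eq_bigr => i _; rewrite pure_kraus_state.
Qed.

Lemma overlap_choi n (K : 'I_n -> 'M[C]_2) :
  overlap (choi (kraus_map K)) = 2^-1 * \sum_i `|\tr (K i)| ^+ 2.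
Proof.
rewrite choi_kraus_map; under eq_bigr do rewrite -[pure_state _]scale1r.
rewrite overlap_sum mulr_sumr; apply: eq_bigr => i _.
rewrite mul1r overlap_pure coef_kraus_vec mxtraceZ normrM exprMn; congr (_ * _).
rewrite normCK conj_RtoC -RtoCM -invfM -expr2 sqr_sqrtr ?ler0n //.
by rewrite RtoCV RtoC_nat.
Qed.

Lemma Re_normrM (a : R) (z : C) :
  complex.Re `|a%:C * z| = `|a| * complex.Re `|z|.
Proof.
have aE : `|a%:C : C| = `|a|%:C.
  by rewrite normc_def /= expr0n addr0 sqrtr_sqr.
by apply: complexI; rewrite [RHS]RtoCM !RRe_real ?normr_real // normrM aE.
Qed.

(** The 2x2 determinant squares the scalars [1 / sqrt 2] and [1 / sqrt prob]; the resulting 1/2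
    cancels the factor 2 of the concurrence. *)
Lemma concurrence_kraus_state (K : 'M[C]_2) : 0 < kraus_prob K ->
  concurrence (kraus_state K) = complex.Re `|\det K| / kraus_prob K.
Proof.
move=> K0; rewrite /concurrence coef_mxZ coef_kraus_vec scalerA detZ.
rewrite -RtoCM -RtoCX Re_normrM ger0_norm ?sqr_ge0 // exprMn !exprVn.
rewrite (sqr_sqrtr (ltW K0)) sqr_sqrtr ?ler0n //; move: (complex.Re _) K0 => r.
by move: (kraus_prob K) => k k0; field; rewrite gt_eqF.
Qed.

(** Unitary freedom of Kraus decompositions: after expansion, [U] enters only through the Gram
    matrix [U ^t* *m U]. *)
Lemma kraus_map_mix m n (U : 'M[C]_(m, n)) (K : 'I_n -> 'M[C]_2) (A : 'M[C]_2) :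
  U ^t* *m U = 1%:M -> kraus_map (kraus_mix U K) A = kraus_map K A.
Proof.
move=> /matrixP U1; rewrite /kraus_map /kraus_mix.
transitivity (\sum_j \sum_k (U ^t* *m U) k j *: (K j *m A *m (K k) ^t*)).
  under [RHS]eq_bigr do under eq_bigr do rewrite mxE scaler_suml.
  under [RHS]eq_bigr do rewrite exchange_big.
  rewrite [RHS]exchange_big; apply: eq_bigr => i _ /=.
  rewrite !mulmx_suml; apply: eq_bigr => j _.
  rewrite linear_sum rmorph_sum /= mulmx_sumr; apply: eq_bigr => k _.
  rewrite linearZ map_mxZ /= -scalemxAr -!scalemxAl scalerA.
  by rewrite !mxE.
apply: eq_bigr => j _; rewrite (bigD1 j) //= U1 mxE eqxx scale1r.
by rewrite big1 ?addr0 // => k kj; rewrite U1 mxE (negbTE kj) scale0r.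
Qed.

Lemma kraus_mix_complete m n (U : 'M[C]_(m, n)) (K : 'I_n -> 'M[C]_2) :
  U ^t* *m U = 1%:M ->
  \sum_i (kraus_mix U K i) ^t* *m kraus_mix U K i = \sum_i (K i) ^t* *m K i.
Proof.
move=> /matrixP U1; rewrite /kraus_mix.
transitivity (\sum_j \sum_k (U ^t* *m U) k j *: ((K k) ^t* *m K j)).
  under [RHS]eq_bigr do under eq_bigr do rewrite mxE scaler_suml.
  under [RHS]eq_bigr do rewrite exchange_big.
  rewrite [RHS]exchange_big; apply: eq_bigr => i _ /=.
  rewrite mulmx_sumr; apply: eq_bigr => j _.
  rewrite linear_sum rmorph_sum /= mulmx_suml; apply: eq_bigr => k _.
  rewrite [(U i k *: K k)^T]linearZ map_mxZ /= -scalemxAr -!scalemxAl scalerA.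
  by rewrite !mxE mulrC.
apply: eq_bigr => j _; rewrite (bigD1 j) //= U1 mxE eqxx scale1r.
by rewrite big1 ?addr0 // => k kj; rewrite U1 mxE (negbTE kj) scale0r.
Qed.

End Kraus.

(** * The depolarizing channel *)

Section Depolarizing.
Variable R : realType.
Local Notation C := R[i].

Lemma sum_ord4 (V : nmodType) (F : 'I_4 -> V) :
  \sum_i F i = F 0 + F 1 + F 2 + F 3.
Proof.
rewrite !big_ord_recl big_ord0 addr0 !addrA.
by congr (_ + F _ + F _ + F _); exact: val_inj.
Qed.

Lemma mixU_real i j : Num.conj (mixU R i j) = mixU R i j.
Proof.
apply: conj_Creal; rewrite !mxE realM ?realV ?realn //.
by case: i => [[|[|[|[|//]]]] ?]; case: j => [[|[|[|[|//]]]] ?] /=;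
  rewrite ?realN real1.
Qed.

Lemma mixU_unitary : (mixU R) ^t* *m mixU R = 1%:M.
Proof.
apply/matrixP => i j; rewrite mxE.
under eq_bigr do rewrite [_^t* _ _]mxE [_^T _ _]mxE mixU_real.
rewrite sum_ord4 !mxE.
by case: i => [[|[|[|[|//]]]] ?]; case: j => [[|[|[|[|//]]]] ?] /=;
  rewrite ?mulr1n ?mulr0n; field.
Qed.

(** Signs in the last three columns are irrelevant: determinants and norms of the mixed operators
    see only squares of these entries, hence agree on all rows. *)
Lemma mixU_entry i : [/\ mixU R i 0 = 2^-1, mixU R i 1 ^+ 2 = 4^-1,
  mixU R i 2 ^+ 2 = 4^-1 & mixU R i 3 ^+ 2 = 4^-1].
Proof.
by split=> *; rewrite !mxE; case: i => [[|[|[|[|//]]]] ?] /=; field.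
Qed.

Lemma sum_mxtrace2 (M : 'M[C]_2) : \tr (M *m M ^t*) =
  M 0 0 * Num.conj (M 0 0) + M 0 1 * Num.conj (M 0 1) +
  (M 1 0 * Num.conj (M 1 0) + M 1 1 * Num.conj (M 1 1)).
Proof. by rewrite /mxtrace sum_ord2 !mxE !sum_ord2 !mxE. Qed.

(** The depolarizing operators with free amplitudes, which keeps square roots of [p] out of the
    algebra. *)
Definition pauli_kraus (al be : R) : 'I_4 -> 'M[C]_2 :=
  fun i => nth 0 [:: al%:C *: 1%:M; be%:C *: pauliX R; be%:C *: pauliY R;
                     be%:C *: pauliZ R] i.

Lemma pauliX_unitary : (pauliX R) ^t* *m pauliX R = 1%:M.
Proof.
apply/matrixP => i j; rewrite mxE sum_ord2 !mxE.
case: i => [[|[|//]] ?]; case: j => [[|[|//]] ?] /=.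
all: rewrite ?complexiE ?rmorphN /= ?conjC0 ?conjC1 ?conjCi.
all: rewrite ?mul0r ?mulr0 ?mul1r ?mulr1 ?mulrNN ?mulNr ?mulrN -?expr2 ?sqrCi.
all: by rewrite ?expr1n ?opprK ?addr0 ?add0r ?opprK ?oppr0.
Qed.

Lemma pauliY_unitary : (pauliY R) ^t* *m pauliY R = 1%:M.
Proof.
apply/matrixP => i j; rewrite mxE sum_ord2 !mxE.
case: i => [[|[|//]] ?]; case: j => [[|[|//]] ?] /=.
all: rewrite ?complexiE ?rmorphN /= ?conjC0 ?conjC1 ?conjCi.
all: rewrite ?mul0r ?mulr0 ?mul1r ?mulr1 ?mulrNN ?mulNr ?mulrN -?expr2 ?sqrCi.
all: by rewrite ?expr1n ?opprK ?addr0 ?add0r ?opprK ?oppr0.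
Qed.

Lemma pauliZ_unitary : (pauliZ R) ^t* *m pauliZ R = 1%:M.
Proof.
apply/matrixP => i j; rewrite mxE sum_ord2 !mxE.
case: i => [[|[|//]] ?]; case: j => [[|[|//]] ?] /=.
all: rewrite ?complexiE ?rmorphN /= ?conjC0 ?conjC1 ?conjCi.
all: rewrite ?mul0r ?mulr0 ?mul1r ?mulr1 ?mulrNN ?mulNr ?mulrN -?expr2 ?sqrCi.
all: by rewrite ?expr1n ?opprK ?addr0 ?add0r ?opprK ?oppr0.
Qed.

Lemma pauli_kraus_complete (al be : R) : al ^+ 2 + 3 * be ^+ 2 = 1 ->
  \sum_i (pauli_kraus al be i) ^t* *m pauli_kraus al be i = 1%:M.
Proof.
move=> /(congr1 (real_complex R)); rewrite RtoCD RtoCM !RtoCX RtoC_nat => ab.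
have {}ab : al%:C ^+ 2 = 1 - 3 * be%:C ^+ 2 :> C by apply: (canRL (addrK _)); exact: ab.
rewrite sum_ord4 /pauli_kraus /=.
have scale_adj (x : R) (P : 'M[C]_2) : P ^t* *m P = 1%:M ->
    (x%:C *: P) ^t* *m (x%:C *: P) = x%:C ^+ 2 *: 1%:M.
  move=> P1; rewrite [(_ *: P)^T]linearZ map_mxZ /= conj_RtoC.
  by rewrite -scalemxAl -scalemxAr P1 scalerA.
transitivity (al%:C ^+ 2 *: 1%:M + be%:C ^+ 2 *: 1%:M + be%:C ^+ 2 *: 1%:M
  + be%:C ^+ 2 *: 1%:M : 'M[C]_2).
  congr (_ + _ + _ + _); apply: scale_adj.
  - by rewrite trmx1 map_mx1 mulmx1.
  - exact: pauliX_unitary.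
  - exact: pauliY_unitary.
  - exact: pauliZ_unitary.
rewrite -!scalerDl ab -[RHS]scale1r; congr (_ *: _); ring.
Qed.

Lemma mixed_pauli_krausE (al be : R) i x y :
  kraus_mix (mixU R) (pauli_kraus al be) i x y =
    mixU R i 0 * (al%:C * (x == y)%:R) + mixU R i 1 * (be%:C * pauliX R x y) +
    mixU R i 2 * (be%:C * pauliY R x y) + mixU R i 3 * (be%:C * pauliZ R x y).
Proof.
have scale2 (a b : C) (P : 'M[C]_2) : (a *: (b *: P)) x y = a * (b * P x y).
  by rewrite !mxE.
rewrite /kraus_mix summxE sum_ord4; congr (_ + _ + _ + _); rewrite scale2 //.
by congr (_ * (_ * _)); rewrite mxE.
Qed.

Lemma mixed_pauli_kraus_entries (al be : R) i
    (u := mixU R i) (L := kraus_mix (mixU R) (pauli_kraus al be) i) :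
  [/\ L 0 0 = u 0 * al%:C + u 3 * be%:C,
      L 0 1 = be%:C * (u 1 - u 2 * 'i),
      L 1 0 = be%:C * (u 1 + u 2 * 'i) &
      L 1 1 = u 0 * al%:C - u 3 * be%:C].
Proof.
rewrite /L -/u; split; rewrite mixed_pauli_krausE -/u;
  move: (u 0) (u 1) (u 2) (u 3) => u0 u1 u2 u3; rewrite !mxE /= ?complexiE; ring.
Qed.

(** With [u] the row of [mixU], the determinant is [u0^2 al^2 - (u1^2 + u2^2 + u3^2) be^2], and each
    square is 1/4. *)
Lemma det_mixed_pauli_kraus (al be : R) i :
  \det (kraus_mix (mixU R) (pauli_kraus al be) i) =
    ((al ^+ 2 - 3 * be ^+ 2) / 4)%:C.
Proof.
rewrite det_mx2; have [-> -> -> ->] := mixed_pauli_kraus_entries al be i.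
have [-> u1 u2 u3] := mixU_entry i.
have -> : ((al ^+ 2 - 3 * be ^+ 2) / 4)%:C = (al%:C ^+ 2 - 3 * be%:C ^+ 2) / 4 :> C.
  rewrite RtoCM RtoCV (RtoC_nat R 4) -!RtoCX -(RtoC_nat R 3) -RtoCM.
  by rewrite -(rmorphB (real_complex R)).
transitivity (4^-1 * al%:C ^+ 2 - mixU R i 3 ^+ 2 * be%:C ^+ 2 - be%:C ^+ 2 *
  (mixU R i 1 ^+ 2 - mixU R i 2 ^+ 2 * 'i ^+ 2)).
  by field.
by rewrite u1 u2 u3 sqrCi; field.
Qed.

Lemma mxtrace_mixed_pauli_kraus (al be : R) i
    (L := kraus_mix (mixU R) (pauli_kraus al be) i) :
  \tr (L *m L ^t*) = ((al ^+ 2 + 3 * be ^+ 2) / 2)%:C.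
Proof.
have -> : ((al ^+ 2 + 3 * be ^+ 2) / 2)%:C = (al%:C ^+ 2 + 3 * be%:C ^+ 2) / 2 :> C.
  rewrite RtoCM RtoCV (RtoC_nat R 2) -!RtoCX -(RtoC_nat R 3) -RtoCM.
  by rewrite -(rmorphD (real_complex R)).
rewrite sum_mxtrace2; have [-> -> -> ->] := mixed_pauli_kraus_entries al be i.
rewrite !(rmorphD, rmorphN, rmorphM) /= !conj_RtoC !mixU_real conjCi.
have [-> u1 u2 u3] := mixU_entry i.
transitivity (2 * 4^-1 * al%:C ^+ 2 + 2 * mixU R i 3 ^+ 2 * be%:C ^+ 2 +
  2 * be%:C ^+ 2 * (mixU R i 1 ^+ 2 - mixU R i 2 ^+ 2 * 'i ^+ 2)).
  by field.
by rewrite u1 u2 u3 sqrCi; field.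
Qed.

(** The Pauli matrices are traceless, so only the identity term contributes. *)
Lemma sum_sqr_mxtrace_pauli_kraus (al be : R) :
  \sum_i `|\tr (pauli_kraus al be i)| ^+ 2 = (4 * al ^+ 2)%:C.
Proof.
rewrite sum_ord4 /pauli_kraus /= !mxtraceZ mxtrace1 /mxtrace !sum_ord2 !mxE /=.
rewrite addr0 subrr !mulr0 normr0 expr0n /= !addr0 normrM exprMn normr_nat normCK.
by rewrite conj_RtoC RtoCM RtoCX (RtoC_nat R 4); ring.
Qed.

End Depolarizing.

Theorem proposition10 (R : realType) (p : R) (hp0 : 0 <= p) (hp1 : p < 2 / 3) :
  optimal_for_choi (depolarizing p) (kraus_mix (mixU R) (depolarizing_kraus p)).
Proof.
pose al : R := Num.sqrt (1 - 3 * p / 4); pose be : R := Num.sqrt p / 2.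
have al2 : al ^+ 2 = 1 - 3 * p / 4.
  have h : 0 <= 1 - 3 * p / 4 by lra.
  exact: sqr_sqrtr.
have be2 : be ^+ 2 = p / 4.
  by rewrite /be exprMn sqr_sqrtr // exprVn; field.
have RtoC_half : (2^-1)%:C = 2^-1 :> R[i] by rewrite RtoCV (RtoC_nat R 2).
pose K := pauli_kraus al be; pose L := kraus_mix (mixU R) K.
have -> : depolarizing p = kraus_map K by [].
rewrite -[depolarizing_kraus p]/K -/L.
have mapL : kraus_map K = kraus_map L.
  by apply/funext => A; rewrite kraus_map_mix // mixU_unitary.
have L1 : \sum_i (L i) ^t* *m L i = 1%:M.
  rewrite kraus_mix_complete ?mixU_unitary // pauli_kraus_complete //.
  by rewrite al2 be2; field.
have probL i : kraus_prob (L i) = 4^-1.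
  apply: complexI; rewrite kraus_probE mxtrace_mixed_pauli_kraus al2 be2.
  by rewrite -RtoC_half -RtoCM; congr (real_complex R _); field.
have prob0 i : 0 < kraus_prob (L i) by rewrite probL invr_gt0 ltr0n.
(* Here [al^2 - 3 be^2 = 1 - 3p/2], which is positive exactly below the threshold 2/3, so the
   absolute value can be removed. *)
have concL i : concurrence (kraus_state (L i)) = 1 - 3 * p / 2.
  rewrite concurrence_kraus_state // probL det_mixed_pauli_kraus -[_%:C]mulr1.
  rewrite Re_normrM normr1 /= mulr1 ger0_norm al2 be2; last by lra.
  by field.
have conc0 : 0 < 1 - 3 * p / 2 by lra.
have normL i : l2norm (kraus_state (L i)) = 1 by exact: l2norm_kraus_state.
have avgL : avg_entanglement (fun i => kraus_prob (L i)) (fun i => kraus_state (L i))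
    = entanglement (kraus_state (L 0)).
  apply: weighted_mean_const (sum_kraus_prob L1) _ => i.
  apply: (eq_entanglement (normL i) (normL 0)); first by rewrite (concL i).
  exact: etrans (concL i) (esym (concL 0)).
split; first by split=> // A; rewrite mapL.
apply/eqP; rewrite eq_le; apply/andP; split; last first.
  (* The infimum is at most the average over the ensemble induced by [L], which decomposes the same
     Choi state. *)
  apply: ereal_inf_lbound; do 3!eexists; split; last by [].
  by rewrite mapL; exact: kraus_ensemble.
apply/ereal_infP => _ [n [q [psi [ens ->]]]]; rewrite lee_fin avgL.
apply: avg_entanglement_ge ens; rewrite ?concL //.
(* The overlap, computed from the unmixed operators, is [2 al^2 = 2 - 3p/2]: exactly 1 plus the
   common concurrence. *)
rewrite overlap_choi sum_sqr_mxtrace_pauli_kraus al2.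
by rewrite -RtoC_half -RtoCM; congr (real_complex R _); field.
Qed.
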